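(* Let $k\geq 1$ be an integer, let $q\equiv 2k+1 \pmod{4k}$ be a prime power, and let $V=V_0\cup V_1\cup\dots\cup V_{k-1}$ be a cyclotomic half-set of $\mathbb{F}_q$ of order $2k$ (with $V_i=(-1)^{\alpha_i}C^{2k}_i$ as in the context). If there exists a $(V,k,r)$ Heffter difference matrix, then there exists a $(\frac{q-1}{2},k;r)$ Heffter space. If the matrix is simple, the Heffter space is simple as well.
   Context: Let $g$ be a fixed primitive element of $\mathbb{F}_q$. $C^{2k}$ denotes the subgroup of index $2k$ of $\mathbb{F}_q^*$, and $C^{2k}_i=g^iC^{2k}$ for $0\le i\le 2k-1$ (the cyclotomic classes of order $2k$). Since $q\equiv 2k+1 \pmod{4k}$, $-1\in C^{2k}_k$. A cyclotomic half-set of $\mathbb{F}_q$ of order $2k$ is a set $V=\bigcup_{i=0}^{k-1}(-1)^{\alpha_i}C^{2k}_i$ with $\alpha_i\in\{0,1\}$; one writes $V_i=(-1)^{\alpha_i}C^{2k}_i$ and assumes $\alpha_0=0$. A $(V,k,r)$ Heffter difference matrix is an $r\times k$ matrix $B=(b_{h,i})$ (rows indexed $1,\dots,r$, columns $0,\dots,k-1$) with entries in $\mathbb{F}_q$ such that: (i) every row is zero-sum in $\mathbb{F}_q$; (ii) every entry of column $i$ lies in $V_i$, for $0\le i\le k-1$; (iii) for $0\le i<j\le k-1$ the multiset $\{b_{h,i}/b_{h,j} : 1\le h\le r\}$ has no repeated elements. It is simple if, for each row $(b_{h,0},\dots,b_{h,k-1})$, the partial sums $b_{h,0}, b_{h,0}+b_{h,1},\dots,b_{h,0}+\dots+b_{h,k-1}$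 are pairwise distinct. A $(v_r,b_k)$ configuration is a point-block incidence structure $(V,\mathcal{B})$ with $v$ points and $b$ blocks, each block a $k$-subset, any two distinct points in at most one common block, every point in exactly $r$ blocks; it is resolvable if $\mathcal{B}$ partitions into $r$ parallel classes, each a partition of $V$. A half-set of an abelian group $G$ is $V\subseteq G$ with $V$ and $-V$ partitioning $G\setminus\{0\}$. A $(v,k;r)$ Heffter space over an abelian group $G$ is a resolvable $(v_r,b_k)$ configuration whose point set is a half-set of $G$ and whose blocks are all zero-sum in $G$. It is simple if every block can be ordered so that its partial sums are pairwise distinct. *)

(* Defs.v *)
From HB Require Import structures.
From mathcomp Require Import all_boot all_order all_algebra all_fingroup all_solvable.

Set Implicit Arguments.
Unset Strict Implicit.
Unset Printing Implicit Defensive.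

Import GRing.Theory.
Local Open Scope ring_scope.

(* [scanl +%R 0 [:: x1; ...; xn]] is [:: x1; x1 + x2; ...; x1 + ... + xn]:
   the initial 0 is not listed, the total sum is. *)
Definition simple_seq (G : finZmodType) (s : seq G) : Prop :=
  uniq (scanl +%R 0 s).

Section Configurations.
Variable T : finType.
Implicit Types (P : {set T}) (Bl : {set {set T}}).

Definition configuration (v r b k : nat) P Bl : Prop :=
  [/\ #|P| = v /\ #|Bl| = b,
      forall A, A \in Bl -> A \subset P /\ #|A| = k,
      forall x y, x \in P -> y \in P -> x != y ->
        (#|[set A in Bl | (x \in A) && (y \in A)]| <= 1)%N
    & forall x, x \in P -> #|[set A in Bl | x \in A]| = r].

Definition parallel_class P (C : {set {set T}}) : Prop := partition C P.

Definition resolvable (r : nat) P Bl : Prop :=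
  exists R : {set {set {set T}}},
    [/\ partition R Bl, #|R| = r & forall C, C \in R -> parallel_class P C].

End Configurations.

Section HeffterSpaces.
Variable G : finZmodType.
Implicit Types (P A : {set G}) (Bl : {set {set G}}).

Definition half_set P : Prop :=
  [disjoint P & [set - x | x in P]] /\ P :|: [set - x | x in P] = ~: [set 0].

Definition zero_sum A : Prop := \sum_(x in A) x = 0.

Definition heffter_space (v k r : nat) P Bl : Prop :=
  [/\ exists b, configuration v r b k P Bl,
      resolvable r P Bl,
      half_set P
    & forall A, A \in Bl -> zero_sum A].

Definition simple_space Bl : Prop :=
  forall A, A \in Bl -> exists s, perm_eq s (enum A) /\ simple_seq s.

End HeffterSpaces.

Section Cyclotomy.
Variables (F : finFieldType) (g : {unit F}) (C : {group {unit F}}).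

Definition cyclotomic_class (i : nat) : {set F} :=
  [set FinRing.uval u | u in (g ^+ i *: C)%g].

Variables (k : nat) (alpha : 'I_k -> bool).

Definition signed_class (i : 'I_k) : {set F} :=
  [set (-1) ^+ alpha i * x | x in cyclotomic_class i].

(* C is meant to be the subgroup of index 2k of the unit group; the second
   conjunct is the normalisation alpha_0 = 0. *)
Definition cyclotomic_half_set (V : {set F}) : Prop :=
  V = \bigcup_(i < k) signed_class i /\
  (forall i : 'I_k, i = 0%N :> nat -> alpha i = false).

End Cyclotomy.

Section HeffterDifferenceMatrices.
Variables (F : finFieldType) (k r : nat).

Definition heffter_difference_matrix (V_ : 'I_k -> {set F})
    (B : 'M[F]_(r, k)) : Prop :=
  [/\ forall h, \sum_i B h i = 0,
      forall h i, B h i \in V_ i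
    & forall i j : 'I_k, (i < j)%N -> injective (fun h => B h i / B h j)].

Definition simple_matrix (B : 'M[F]_(r, k)) : Prop :=
  forall h, simple_seq [seq B h i | i <- enum 'I_k].

End HeffterDifferenceMatrices.

(* Main.v *)
Require Import Defs.
From HB Require Import structures.
From mathcomp Require Import all_boot all_order all_algebra all_fingroup all_solvable.
From mathcomp Require Import finfield zify.

(** Let [c] be the order of [C^{2k}].  The map [x |-> x ^+ c] separates the
    cyclotomic classes: [C^{2k}] consists of the [x] with [x ^+ c = 1], and with
    [z := g ^+ c], a primitive [2k]-th root of unity with [z ^+ k = -1], the
    signed class [V_i] is [{x | x ^+ c = (-1) ^+ alpha_i * z ^+ i}].  The
    congruence on [q] says that [c] is odd, which makes the union of the [V_i]
    a half-set.  The blocks are the dilates by [C^{2k}] of the rows of the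
    matrix; the dilates of one row form a parallel class.  Two distinct points
    [x], [y] of a block lie in distinct classes [V_i], [V_j], so [x / y] is the
    quotient of two entries of the row that yields the block; this quotient
    determines the row, and then [x] determines the dilation factor. *)

Set Implicit Arguments.
Unset Strict Implicit.
Unset Printing Implicit Defensive.

Import GRing.Theory.
Local Open Scope ring_scope.

(** * Scaling of partial sums, and the size of a half-set *)

Lemma scanl_scale (R : pzRingType) (a x : R) (s : seq R) :
  scanl +%R (a * x) [seq a * y | y <- s] = [seq a * y | y <- scanl +%R x s].
Proof. by elim: s x => //= y s IHs x; rewrite -mulrDr IHs. Qed.

Lemma simple_seq_scale (F : finFieldType) (a : F) (s : seq F) :
  a != 0 -> simple_seq s -> simple_seq [seq a * x | x <- s].
Proof.
(* The initial value 0 is read as [a * 0], so that the whole scan is a scaled one. *)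
move=> a0 s_simple; rewrite /simple_seq -[X in scanl _ X](mulr0 a) scanl_scale.
by rewrite map_inj_uniq //; apply: mulfI.
Qed.

Lemma half_set_card (F : finFieldType) (P : {set F}) :
  half_set P -> #|P| = ((#|F| - 1) %/ 2)%N.
Proof.
case=> disjP defP; have := congr1 (fun A : {set F} => #|A|) defP.
rewrite cardsU (eqP (_ : _ :&: _ == set0)) ?setI_eq0 // cards0 subn0 cardsC1.
rewrite card_imset; last exact: oppr_inj.
by rewrite addnn -subn1 => <-; rewrite -muln2 mulnK.
Qed.

(** * The resolvable configuration formed by the dilates of the rows *)

Section Dilates.

Variables (F : finFieldType) (H I : finType) (b : H -> I -> F).
Variables (c : nat) (d : I -> F).
Hypothesis c_gt0 : (0 < c)%N.
Hypothesis d_inj : injective d.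
Hypothesis b_neq0 : forall h i, b h i != 0.
Hypothesis b_exp : forall h i, b h i ^+ c = d i.
Hypothesis b_sum0 : forall h, \sum_i b h i = 0.
Hypothesis b_ratio : forall i j, i != j -> injective (fun h => b h i / b h j).

Definition roots_of_one : {set F} := [set a | a ^+ c == 1].
Definition dilate h (a : F) : {set F} := [set a * b h i | i : I].
Definition dilates h : {set {set F}} := [set dilate h a | a in roots_of_one].
Definition points : {set F} := [set x | [exists i, x ^+ c == d i]].
Definition blocks : {set {set F}} :=
  [set dilate h a | h : H, a : F in roots_of_one].

Lemma roots_of_one_neq0 a : a \in roots_of_one -> a != 0.
Proof.
rewrite inE; apply: contraTneq => ->.
by rewrite expr0n eqn0Ngt c_gt0 /= eq_sym oner_eq0.
Qed.

Lemma roots_of_one1 : 1 \in roots_of_one.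
Proof. by rewrite inE expr1n. Qed.

Lemma roots_of_one_ratio h i x :
  x ^+ c = d i -> x / b h i \in roots_of_one.
Proof.
by move=> xc; rewrite inE expr_div_n xc -(b_exp h i) divff ?expf_neq0.
Qed.

Lemma dilate_exp h a i : a \in roots_of_one -> (a * b h i) ^+ c = d i.
Proof. by rewrite inE exprMn => /eqP->; rewrite mul1r. Qed.

Lemma dilate_entry_inj h a :
  a \in roots_of_one -> injective (fun i => a * b h i).
Proof.
move=> aC i j eq_ij; apply: d_inj.
by rewrite -(dilate_exp h i aC) eq_ij dilate_exp.
Qed.

Lemma card_dilate h a : a \in roots_of_one -> #|dilate h a| = #|I|.
Proof. by move=> aC; rewrite card_imset //; apply: dilate_entry_inj. Qed.

(** A block has exactly one entry per column, and the [c]-th power of a point reveals its column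
    because [d] is injective. *)
Lemma mem_dilate h a x i :
  a \in roots_of_one -> x \in dilate h a -> x ^+ c = d i -> x = a * b h i.
Proof.
move=> aC /imsetP[j _ ->]; rewrite dilate_exp // => /d_inj.
by move->.
Qed.

Lemma dilate_sub h a : a \in roots_of_one -> dilate h a \subset points.
Proof.
move=> aC; apply/subsetP=> x /imsetP[i _ ->]; rewrite inE.
by apply/existsP; exists i; rewrite dilate_exp.
Qed.

Lemma dilate_same_row h a a' x :
    a \in roots_of_one -> a' \in roots_of_one ->
  x \in dilate h a -> x \in dilate h a' -> a = a'.
Proof.
move=> aC a'C /imsetP[i _ ->] /mem_dilate-/(_ i a'C (dilate_exp _ _ aC)).
exact: mulIf.
Qed.

Lemma dilate_two_points h h' a a' x y :
    a \in roots_of_one -> a' \in roots_of_one -> x != y ->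
    x \in dilate h a -> y \in dilate h a ->
    x \in dilate h' a' -> y \in dilate h' a' ->
  h = h' /\ a = a'.
Proof.
move=> aC a'C neq_xy xA yA xA' yA'.
have eq_h : h = h'.
  case/imsetP: xA neq_xy xA' => i _ ->; case/imsetP: yA yA' => j _ -> yA' neq_xy.
  have neq_ij : i != j by apply: contraNneq neq_xy => ->.
  move=> /mem_dilate-/(_ i a'C (dilate_exp _ _ aC)) eq_i.
  move: yA' => /mem_dilate-/(_ j a'C (dilate_exp _ _ aC)) eq_j.
  apply: (b_ratio neq_ij) => /=.
  (* Expanding the quotient by [a / a] turns it into the quotient of the two points, which is also
     that of two entries of [dilate h' a']; there [a'] cancels. *)
  rewrite -[LHS]mul1r -(divff (roots_of_one_neq0 aC)) mulf_div eq_i eq_j.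
  by rewrite -mulf_div divff ?mul1r ?roots_of_one_neq0.
by split=> //; subst h'; apply: dilate_same_row xA xA'.
Qed.

(* A row with a single entry would not be zero-sum. *)
Lemma exists_other_column (h : H) (i : I) : exists j, j != i.
Proof.
apply/existsP; apply: contraT => /existsPn all_i; have := b_sum0 h.
rewrite (bigD1 i) //= big1 ?addr0; last by move=> j; rewrite (negbTE (all_i j)).
by move/eqP; rewrite (negbTE (b_neq0 h i)).
Qed.

(** A block has at least two points, and two points already determine the row and the factor. The
    column [i] excludes empty blocks, which would all coincide. *)
Lemma dilate_inj (i : I) h h' a a' :
    a \in roots_of_one -> a' \in roots_of_one ->
  dilate h a = dilate h' a' -> h = h' /\ a = a'.
Proof.
move=> aC a'C eqA; have [j neq_ji] := exists_other_column h i.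
have mem_h l : a * b h l \in dilate h a by apply: imset_f.
apply: (@dilate_two_points _ _ _ _ (a * b h j) (a * b h i)); rewrite -?eqA //.
by apply: contra neq_ji => /eqP/(dilate_entry_inj aC)->.
Qed.

Lemma dilates_partition (i : I) h : partition (dilates h) points.
Proof.
apply/and3P; split.
- rewrite eqEsubset; apply/andP; split.
    by apply/bigcupsP=> A /imsetP[a aC ->]; apply: dilate_sub.
  apply/subsetP=> x; rewrite inE => /existsP[j /eqP xc].
  (* The only factor that can move the entry of column [j] to [x]. *)
  apply/bigcupP; exists (dilate h (x / b h j)).
    by rewrite imset_f ?roots_of_one_ratio.
  by apply/imsetP; exists j; rewrite ?divfK.
- apply/trivIsetP=> _ _ /imsetP[a aC ->] /imsetP[a' a'C ->].
  apply: contraR => /pred0Pn[x /andP[/= xA xA']].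
  by rewrite (dilate_same_row aC a'C xA xA').
- apply/imsetP=> -[a aC] /esym/eqP; rewrite -cards_eq0 card_dilate //.
  by apply/negP; rewrite -lt0n; apply/card_gt0P; exists i.
Qed.

Lemma dilates_disjoint (i : I) h h' A :
  A \in dilates h -> A \in dilates h' -> h = h'.
Proof.
case/imsetP=> a aC -> /imsetP[a' a'C] eqA.
by case: (dilate_inj i aC a'C eqA).
Qed.

Lemma dilates_neq0 h : dilates h != set0.
Proof. by apply/set0Pn; exists (dilate h 1); rewrite imset_f ?roots_of_one1. Qed.

Lemma blocks_resolvable (i : I) : resolvable #|H| points blocks.
Proof.
exists [set dilates h | h : H]; split.
- apply/and3P; split.
  + rewrite eqEsubset; apply/andP; split.
      apply/bigcupsP=> _ /imsetP[h _ ->]; apply/subsetP=> _ /imsetP[a aC ->].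
      by apply/imset2P; exists h a.
    apply/subsetP=> _ /imset2P[h a _ aC ->]; apply/bigcupP.
    by exists (dilates h); rewrite imset_f.
  + apply/trivIsetP=> _ _ /imsetP[h _ ->] /imsetP[h' _ ->].
    apply: contraR => /pred0Pn[A /andP[/= Ah Ah']].
    by rewrite (dilates_disjoint i Ah Ah').
  + apply/imsetP=> -[h _] /esym/eqP.
    by rewrite (negbTE (dilates_neq0 h)).
(* Equal classes share a block, as they are nonempty, so they come from the same row. *)
- rewrite card_imset // => h h' eq_hh'; have /set0Pn[A Ah] := dilates_neq0 h.
  by apply: (dilates_disjoint i Ah); rewrite -eq_hh'.
- by move=> _ /imsetP[h _ ->]; apply: dilates_partition.
Qed.

(** If [x] belongs to column [j], each row [h] has exactly one dilate through [x], with factor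
    [x / b h j], and different rows give different blocks. *)
Lemma card_blocks_through (i : I) x :
  x \in points -> #|[set A in blocks | x \in A]| = #|H|.
Proof.
rewrite inE => /existsP[j /eqP xc].
have ratioC h := roots_of_one_ratio h xc.
rewrite -(@card_imset _ _ (fun h => dilate h (x / b h j)) predT); last first.
  by move=> h h' /(dilate_inj i (ratioC h) (ratioC h'))[].
apply: eq_card => A; apply/idP/imsetP=> [|[h _ ->]].
  rewrite inE => /andP[/imset2P[h a _ aC ->] xA]; exists h => //.
  by rewrite {1}(mem_dilate aC xA xc) mulfK.
rewrite inE; apply/andP; split; first by apply/imset2P; exists h (x / b h j).
by apply/imsetP; exists j; rewrite ?divfK.
Qed.

Lemma blocks_configuration (i : I) :
  configuration #|points| #|H| #|blocks| #|I| points blocks.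
Proof.
split=> // [_ /imset2P[h a _ aC ->]|x y _ _ neq_xy|x xP].
- by rewrite dilate_sub ?card_dilate.
- apply/card_le1_eqP=> A A' /setIdP[/imset2P[h a _ aC ->] /andP[xA yA]].
  move=> /setIdP[/imset2P[h' a' _ a'C ->] /andP[xA' yA']].
  by have [-> ->] := dilate_two_points aC a'C neq_xy xA yA xA' yA'.
- exact: card_blocks_through.
Qed.

Lemma blocks_zero_sum A : A \in blocks -> zero_sum A.
Proof.
case/imset2P=> h a _ aC ->; rewrite /zero_sum big_imset /=; last first.
  by move=> i j _ _; apply: dilate_entry_inj.
by rewrite -mulr_sumr b_sum0 mulr0.
Qed.

Lemma blocks_simple :
  (forall h, simple_seq [seq b h i | i <- enum I]) -> simple_space blocks.
Proof.
move=> b_simple _ /imset2P[h a _ aC ->].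
(* The block is listed in the column order of its row; the nonzero factor keeps the partial sums
   distinct. *)
exists [seq a * x | x <- [seq b h i | i <- enum I]]; split; last first.
  by apply: simple_seq_scale; rewrite ?roots_of_one_neq0.
rewrite -map_comp; apply: uniq_perm; rewrite ?enum_uniq //.
  by rewrite map_inj_uniq ?enum_uniq //; apply: dilate_entry_inj.
move=> x; rewrite mem_enum; apply/mapP/imsetP=> -[i _ ->]; exists i => //.
by rewrite mem_enum.
Qed.

End Dilates.

(** * Cyclotomic classes and half-sets through [c]-th powers *)

Section CyclotomicClasses.

Variables (F : finFieldType) (k : nat).
Hypothesis k_gt0 : (0 < k)%N.
Hypothesis q_mod : #|F| = 2 * k + 1 %[mod 4 * k].
Variable g : {unit F}.
Hypothesis g_prim : generator [set: {unit F}]%G g.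
Variable C : {group {unit F}}.
Hypothesis C_index : #|[set: {unit F}] : C|%g = (2 * k)%N.

Local Notation c := #|C|.
Local Notation z := (FinRing.uval g ^+ c).

Lemma card_units_index : #|F|.-1 = (2 * k * c)%N.
Proof. by rewrite -card_finField_unit -(Lagrange (subsetT C)) C_index mulnC. Qed.

Lemma odd_card_cyclotomic : odd c.
Proof.
have F_gt1 := finNzRing_gt1 F; have cardF := card_units_index.
(* This is the congruence on q with 1 subtracted; cancelling [2 * k] leaves c = 1 modulo 2. *)
have: 2 * k * c = 2 * k * 1 %[mod 2 * k * 2].
  apply/eqP; rewrite muln1 -(eqn_modDr 1) -cardF addn1 prednK; last by lia.
  by rewrite (_ : 2 * k * 2 = 4 * k)%N ?q_mod //; lia.
rewrite -!muln_modr => /eqP.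
by rewrite eqn_pmul2l ?modn2; [case: (odd c) | lia].
Qed.

Lemma prim_root_exp_eq1 n : (z ^+ n == 1) = (2 * k %| n)%N.
Proof.
have g_order : #[g]%g = (c * (2 * k))%N.
  rewrite mulnC -card_units_index -card_finField_unit orderE.
  by rewrite -(eqP g_prim).
rewrite -exprM -FinRing.val_unitX -[1]/(val (1%g : {unit F})).
by rewrite (inj_eq val_inj) -order_dvdn g_order dvdn_pmul2l.
Qed.

Lemma cyclotomic_prim_root : (2 * k).-primitive_root z.
Proof.
apply/andP; split; first by lia.
apply/forallP=> i; rewrite unity_rootE prim_root_exp_eq1; apply/eqP.
apply/idP/eqP=> [/dvdn_leq-/(_ isT)|->//].
by have := ltn_ord i; lia.
Qed.

(** The square of [z ^+ k] is 1, but [z ^+ k] is not 1 since [2 * k] does not divide [k]. *)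
Lemma prim_root_exp_half : z ^+ k = -1.
Proof.
have /eqP : (z ^+ k) ^+ 2 = 1.
  by apply/eqP; rewrite -exprM mulnC prim_root_exp_eq1.
rewrite sqrf_eq1 prim_root_exp_eq1 => /orP[/dvdn_leq-/(_ k_gt0)|/eqP//].
by lia.
Qed.

Lemma cyclotomic_class_exp i x :
  x \in cyclotomic_class g C i -> x ^+ c = z ^+ i.
Proof.
case/imsetP=> _ /lcosetP[u uC ->] ->.
rewrite FinRing.val_unitM exprMn -[X in _ * X]FinRing.val_unitX expg_cardG //.
by rewrite mulr1 FinRing.val_unitX exprAC.
Qed.

Lemma exprN_cyclotomic (x : F) : (- x) ^+ c = - x ^+ c.
Proof. by rewrite exprNn -signr_odd odd_card_cyclotomic mulN1r. Qed.

Definition signed_root (e : bool) (i : 'I_k) : F := (-1) ^+ e * z ^+ i.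

(** Absorbing the sign into the exponent matches the pairs [(e, i)] with the exponents 0, ..., 2k -
    1, hence with all the 2k-th roots of unity. *)
Lemma signed_rootE e i : signed_root e i = z ^+ (i + k * e).
Proof. by rewrite exprD (exprM _ k) prim_root_exp_half mulrC. Qed.

Lemma signed_rootN e i : - signed_root e i = signed_root (~~ e) i.
Proof. by rewrite /signed_root -mulNr; case: e; rewrite ?opprK. Qed.

Lemma signed_root_inj e e' i i' :
  signed_root e i = signed_root e' i' -> e = e' /\ i = i'.
Proof.
have [lt_i lt_i'] := (ltn_ord i, ltn_ord i').
move/eqP; rewrite !signed_rootE (eq_prim_root_expr cyclotomic_prim_root).
rewrite !modn_small; [| by case: e' {e}; lia | by case: e {e'}; lia].
by case: e; case: e' => /eqP eq_ii'; split=> //; try apply: ord_inj; lia.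
Qed.

Lemma signed_root_surj x : x != 0 -> exists e i, x ^+ c = signed_root e i.
Proof.
move=> x0; have xq1 : (x ^+ c) ^+ (2 * k) = 1.
  (* After multiplication by [x] this is x^q = x. *)
  apply: (mulfI x0); rewrite -exprM mulnC -card_units_index -exprS mulr1.
  by rewrite prednK ?expf_card // (ltn_trans _ (finNzRing_gt1 F)).
have [n ->] := prim_rootP cyclotomic_prim_root xq1; have lt_n := ltn_ord n.
have [lt_nk|le_kn] := ltnP n k.
  by exists false, (Ordinal lt_nk); rewrite signed_rootE muln0 addn0.
have lt_nk : (n - k < k)%N by lia.
by exists true, (Ordinal lt_nk); rewrite signed_rootE muln1 subnK.
Qed.

Variable alpha : 'I_k -> bool.
Local Notation d := (fun i => signed_root (alpha i) i).

Lemma signed_class_exp i x :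
  x \in signed_class g C alpha i -> x ^+ c = signed_root (alpha i) i.
Proof.
case/imsetP=> y /cyclotomic_class_exp yc ->; rewrite exprMn yc /signed_root.
by case: (alpha i); rewrite ?exprN_cyclotomic expr1n.
Qed.

Lemma signed_root_neq0 e i : signed_root e i != 0.
Proof.
by rewrite mulf_neq0 ?signr_eq0 // !expf_neq0 // -unitfE; apply: (valP g).
Qed.

Lemma signed_class_neq0 i x : x \in signed_class g C alpha i -> x != 0.
Proof.
move/signed_class_exp; apply: contra_eq_neq => ->.
by rewrite expr0n eqn0Ngt cardG_gt0 /= eq_sym signed_root_neq0.
Qed.

(** A nonzero [x] has [x ^+ c = signed_root e i] for a single pair [(e, i)], and negating [x] flips
    [e] because [c] is odd. So exactly one of [x] and [- x] has the sign [alpha i]. *)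
Lemma points_half_set : half_set (points c d).
Proof.
split.
  apply/pred0P=> x /=; apply/negP=> /andP[].
  rewrite inE => /existsP[i /eqP xc] /imsetP[y].
  rewrite inE => /existsP[j /eqP yc] def_x; move: xc.
  rewrite def_x exprN_cyclotomic yc signed_rootN => /signed_root_inj[+ eq_ji].
  by rewrite eq_ji; case: (alpha i).
apply/setP=> x; rewrite !inE; apply/orP/idP=> [|/signed_root_surj[e [i xc]]].
  have pt_neq0 y : y \in points c d -> y != 0.
    rewrite inE => /existsP[i /eqP]; apply: contra_eq_neq => ->.
    by rewrite expr0n eqn0Ngt cardG_gt0 /= eq_sym signed_root_neq0.
  case=> [xP|/imsetP[y yP ->]]; last by rewrite oppr_eq0 pt_neq0.
  by apply: pt_neq0; rewrite inE.
have [def_e|neq_e] := eqVneq e (alpha i); [left | right].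
  by apply/existsP; exists i; rewrite xc def_e.
apply/imsetP; exists (- x); rewrite ?opprK // inE; apply/existsP; exists i.
rewrite exprN_cyclotomic xc signed_rootN.
by case: e (alpha i) neq_e {xc} => [] [].
Qed.

End CyclotomicClasses.

Theorem theorem2p2 (F : finFieldType) (k r : nat)
    (k_ge1 : (1 <= k)%N)
    (q_mod : #|F| = 2 * k + 1 %[mod 4 * k])
    (g : {unit F}) (g_prim : generator [set: {unit F}]%G g)
    (C : {group {unit F}}) (C_index : #|[set: {unit F}] : C|%g = (2 * k)%N)
    (alpha : 'I_k -> bool) (V : {set F})
    (hV : cyclotomic_half_set g C alpha V)
    (B : 'M[F]_(r, k))
    (hB : heffter_difference_matrix (signed_class g C alpha) B) :
  exists (P : {set F}) (Bl : {set {set F}}),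
    heffter_space ((#|F| - 1) %/ 2) k r P Bl /\
    (simple_matrix B -> simple_space Bl).
Proof.
have [B_sum0 B_class B_ratio] := hB.
pose d (i : 'I_k) := signed_root g C (alpha i) i.
have B_exp h i : B h i ^+ #|C| = d i.
  exact: (signed_class_exp k_ge1 q_mod g_prim C_index) (B_class h i).
have B_neq0 h i : B h i != 0.
  exact: (signed_class_neq0 k_ge1 q_mod g_prim C_index) (B_class h i).
have d_inj : injective d.
  by move=> i j /(signed_root_inj k_ge1 q_mod g_prim C_index)[].
have C_gt0 := cardG_gt0 C.
have ratio_inj i j : i != j -> injective (fun h => B h i / B h j).
  (* The matrix condition covers i < j only; for i > j the quotients are the inverses of those
     covered. *)
  rewrite -val_eqE neq_ltn => /orP[/B_ratio//|/B_ratio ratio_inj] h h' /= eq_r.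
  by apply: ratio_inj; apply: invr_inj; rewrite !invf_div.
have halfP := points_half_set k_ge1 q_mod g_prim C_index alpha.
exists (points #|C| d), (blocks (fun h i => B h i) #|C|); split; last first.
  exact: (blocks_simple C_gt0 d_inj B_exp).
have i0 : 'I_k := Ordinal k_ge1.
have := blocks_resolvable C_gt0 d_inj B_neq0 B_exp B_sum0 ratio_inj i0.
have := blocks_configuration C_gt0 d_inj B_neq0 B_exp B_sum0 ratio_inj i0.
rewrite !card_ord half_set_card // => conf res; split=> //.
  by eexists; exact: conf.
by move=> A; apply: (blocks_zero_sum d_inj B_exp B_sum0).
Qed.
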